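(* Assume $\lfloor (M_1+\dots+M_n)/p\rfloor=n-1$ (ample reduction). Then every polynomial solution $I(z)$ of the KZ system over $\mathbb{F}_p$ belongs to the module $\mathcal{M}=\{\sum_{l=1}^{n-1}c_l(z)I^{[l]}(z):\ c_l\in\mathbb{F}_p[z_1^p,\dots,z_n^p]\}$ of $\mathbb{F}_p$-hypergeometric solutions.
   Context: Let $p,q$ be primes and $n$ a positive integer with $p>n\ge2$, $p>q$. Fix positive integers $m_1,\dots,m_n<q$. For $i\ne j$ let $\Omega_{ij}$ be the $n\times n$ matrix whose only nonzero entries are $(\Omega_{ij})_{ii}=-m_j$, $(\Omega_{ij})_{ij}=m_j$, $(\Omega_{ij})_{ji}=m_i$, $(\Omega_{ij})_{jj}=-m_i$. A polynomial solution of the KZ system over $\mathbb{F}_p$ is $I(z)=(I_1,\dots,I_n)\in\mathbb{F}_p[z_1,\dots,z_n]^n$ with $\partial I/\partial z_i=q^{-1}\sum_{j\ne i}\Omega_{ij}I/(z_i-z_j)$ for all $i$ and $\sum_im_iI_i=0$ (computed in $\mathbb{F}_p$). $M_i$ is the least positive integer with $M_i\equiv -m_iq^{-1}\pmod p$. With $\Phi_p(x,z)=\prod_i(x-z_i)^{M_i}$, $I^{[l]}(z)$ is the coefficient of $x^{lp-1}$ in $(\Phi_p/(x-z_1),\dots,\Phi_p/(x-z_n))$. *)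

(* Defs.v *)
From HB Require Import structures.
From mathcomp Require Import all_boot all_order all_algebra.
From mathcomp Require Import fraction.
From mathcomp.multinomials Require Import mpoly.
Unset Printing Implicit Defensive.
Import Order.TTheory GRing.Theory Num.Theory.
Local Open Scope ring_scope.

Notation Pz p n := {mpoly 'F_p[n]}.
Notation Fz p n := {fraction {mpoly 'F_p[n]}}.

Definition Mexp (p q : nat) (n : nat) (m : 'I_n -> nat) (i : 'I_n) : nat :=
  let r := nat_of_ord (- ((m i)%:R) / (q%:R) : 'F_p) in
  if r == 0%N then p else r.

Definition Omega (p n : nat) (m : 'I_n -> nat) (i j : 'I_n) : 'M['F_p]_n :=
  \matrix_(r, s)
    (if (r == i) && (s == i) then - (m j)%:R
     else if (r == i) && (s == j) then (m j)%:R
     else if (r == j) && (s == i) then (m i)%:R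
     else if (r == j) && (s == j) then - (m i)%:R
     else 0).

Local Notation "x %:F" := (@FracField.tofrac _ x).

Definition KZ_solution (p q n : nat) (m : 'I_n -> nat) (I : 'I_n -> Pz p n) : Prop :=
  (forall (i r : 'I_n),
      ((I r)^`M(i))%:F =
      ((((q%:R : 'F_p)^-1)%:MP : Pz p n))%:F *
      \sum_(j < n | j != i)
         (\sum_(s < n) (Omega p n m i j r s)%:MP * I s)%:F
           / ('X_i - 'X_j : Pz p n)%:F)
  /\ \sum_(i < n) (m i)%:R * I i = 0.

(* Phi_p(x,z) / (x - z_i), as a polynomial in x over F_p[z]. *)
Definition Phi_div (p q n : nat) (m : 'I_n -> nat) (i : 'I_n) : {poly Pz p n} :=
  \prod_(k < n) ('X - ('X_k : Pz p n)%:P) ^+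
      (if k == i then (Mexp p q n m k).-1 else Mexp p q n m k).

Definition Ihyp (p q n : nat) (m : 'I_n -> nat) (l : nat) (i : 'I_n) : Pz p n :=
  (Phi_div p q n m i)`_(l * p - 1).

Definition in_Frob_subring (p n : nat) (c : Pz p n) : Prop :=
  exists d : Pz p n, c = d \mPo [tuple ('X_k : Pz p n) ^+ p | k < n].

(* Main.v *)
Require Import Defs.
From HB Require Import structures.
From mathcomp Require Import all_boot all_order all_algebra.
From mathcomp Require Import fraction.
From mathcomp.multinomials Require Import mpoly.
From mathcomp Require Import zify ring.
Import Order.TTheory GRing.Theory.
Local Open Scope ring_scope.

(* The KZ system amounts to (z_i - z_r) dI_r/dz_i = M_i (I_r - I_i) for i <> r,
   together with sum_i M_i I_i = 0.  Let a be the largest exponent (in the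
   degree-lexicographic order, z_1 > ... > z_n) occurring in a solution I, and v
   the vector of coefficients of z^a.  Comparing top coefficients gives
   a_i v_r = M_i (v_r - v_i) for i < r and a_i v_r = 0 for i > r.  If v_s is the
   first nonzero entry of v, this forces s to be different from the last index and
     a = (M_1, ..., M_(s-1), M_s + ... + M_n, 0, ..., 0)  mod p.
   Under ample reduction the residues of these exponents in [0, p) are exactly the
   leading exponents of the solutions I^[l], so that subtracting c z^(p b) I^[l]
   from I, for suitable c, b and l, lowers the leading exponent. *)

(** * Coefficients and derivatives of products of powers of x - z_k *)

Definition master (R : comNzRingType) (n : nat) (e : 'I_n -> nat) :
    {poly {mpoly R[n]}} :=
  \prod_(k < n) ('X - ('X_k : {mpoly R[n]})%:P) ^+ e k.

(** For e_i > 0 these are the exponents left after division by x - z_i; applied to [Mexp] they give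
    the product in [Phi_div]. *)
Definition lower (n : nat) (e : 'I_n -> nat) (i : 'I_n) : 'I_n -> nat :=
  fun k => if k == i then (e k).-1 else e k.

(** The common bound [N] lets all factors be expanded over one index type, so that the product of
    the sums can be distributed. *)
Lemma exp_subXC (R : comNzRingType) (n : nat) (k : 'I_n) (e N : nat) :
  (e <= N)%N ->
  ('X - ('X_k : {mpoly R[n]})%:P) ^+ e =
  \sum_(j < N.+1) 'X^(e - j) *
     (((-1) ^+ j *+ 'C(e, j)) *: ('X_k : {mpoly R[n]}) ^+ j)%:P.
Proof.
move=> leN; rewrite exprDn (big_ord_widen N.+1
  (fun j => 'X^(e - j) * (- ('X_k : {mpoly R[n]})%:P) ^+ j *+ 'C(e, j))) //.
rewrite big_mkcond; apply: eq_bigr => j _ /=; rewrite ltnS leqNgt.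
case: ltnP => [lt|_] /=; first by rewrite bin_small // mulr0n scale0r mulr0.
rewrite -mulrnAr; congr (_ * _); rewrite -scalerMnl raddfMn; congr (_ *+ _).
by rewrite -polyCN -polyC_exp -['X_k in LHS]scale1r -scaleNr exprZn.
Qed.

(** The term z^m arises by choosing -z_k from m_k of the e_k factors x - z_k; homogeneity then
    forces the power of x. *)
Lemma mcoeff_master (R : comNzRingType) (n : nat) (e : 'I_n -> nat) t m :
  ((master R n e)`_t)@_m =
  if (mdeg m + t == \sum_(k < n) e k)%N
  then \prod_(k < n) ((-1) ^+ m k *+ 'C(e k, m k)) else 0 :> R.
Proof.
set N := (\sum_(k < n) e k)%N.
have leN k : (e k <= N)%N by rewrite /N (bigD1 k) //= leq_addr.
pose c (k : 'I_n) (j : nat) : R := (-1) ^+ j *+ 'C(e k, j).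
have -> : master R n e = \sum_(f : {ffun 'I_n -> 'I_N.+1})
   'X^(\sum_(k < n) (e k - f k)) *
   ((\prod_(k < n) c k (f k)) *: 'X_[[multinom (f k : nat) | k < n]])%:P.
  rewrite /master (eq_bigr _ (fun k _ => exp_subXC R n k _ _ (leN k))).
  rewrite bigA_distr_bigA; apply: eq_bigr => f _.
  rewrite big_split /= prodrXr -rmorph_prod scaler_prod mpolyXE_id.
  by congr (_ * (_ *: _)%:P); apply: eq_bigr => k _; rewrite mnmE.
rewrite coef_sum raddf_sum /=.
have coefE (f : {ffun 'I_n -> 'I_N.+1}) :
  (('X^(\sum_(k < n) (e k - f k)) *
   ((\prod_(k < n) c k (f k)) *: 'X_[[multinom (f k : nat) | k < n]])%:P)`_t)@_m =
   (if (mdeg m + t == N)%N && ([multinom (f k : nat) | k < n] == m)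
    then \prod_(k < n) c k (f k) else 0) :> R.
  rewrite coefMC coefXn.
  have [fm|neq] := eqVneq [multinom (f k : nat) | k < n] m; last first.
    by rewrite andbF mulr_natl mcoeffMn mcoeffZ mcoeffX (negPf neq) mulr0 mul0rn.
  rewrite andbT mulr_natl mcoeffMn mcoeffZ mcoeffX fm eqxx mulr1.
  case: (boolP [forall k, f k <= e k]%N) => [/forallP le_fe|].
    have -> : (t == \sum_(k < n) (e k - f k))%N = (mdeg m + t == N)%N.
      rewrite -(eqn_add2l (mdeg m)); congr (_ == _).
      rewrite mdegE -big_split /=; apply: eq_bigr => k _.
      by rewrite -fm mnmE subnKC.
    by case: eqP; rewrite ?mulr1n ?mulr0n.
  (* If some f_k > e_k, the difference e_k - f_k is truncated, but the binomial coefficient is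
     zero. *)
  rewrite negb_forall => /existsP[k]; rewrite -ltnNge => lt_ef.
  by rewrite (bigD1 k) //= /c bin_small // mulr0n mul0r mul0rn if_same.
rewrite (eq_bigr _ (fun f _ => coefE f)).
case: eqP => [degm|_]; last by rewrite big1.
(* The degree condition bounds every m_k by [N], so [inord] does not change its value. *)
pose f0 : {ffun 'I_n -> 'I_N.+1} := [ffun k => inord (m k)].
have f0E k : f0 k = m k :> nat.
  by rewrite ffunE inordK // ltnS -degm mdegE (bigD1 k) //=; lia.
rewrite (bigD1 f0) //= [X in _ + X]big1 ?addr0.
  have -> : [multinom (f0 k : nat) | k < n] == m.
    by apply/eqP/mnmP => k; rewrite mnmE f0E.
  by apply: eq_bigr => k _; rewrite f0E.
move=> f nef; case: eqP => // fm; case/eqP: nef; apply/ffunP => k; apply: val_inj.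
by rewrite /= f0E -fm mnmE.
Qed.

Lemma sum_lower (n : nat) (e : 'I_n -> nat) (i : 'I_n) :
  (0 < e i)%N -> (\sum_(k < n) lower n e i k).+1 = (\sum_(k < n) e k)%N.
Proof.
move=> ei; rewrite [RHS](bigD1 i) //= (bigD1 i) //= {1}/lower eqxx -addSn prednK //.
by congr addn; apply: eq_bigr => k /negPf ki; rewrite /lower ki.
Qed.

Lemma master_lower (R : comNzRingType) (n : nat) (e : 'I_n -> nat) (i : 'I_n) :
  (0 < e i)%N ->
  master R n e = ('X - ('X_i : {mpoly R[n]})%:P) * master R n (lower n e i).
Proof.
move=> ei; rewrite /master (bigD1 i) //= [in RHS](bigD1 i) //= mulrA -exprS.
rewrite {1}/lower eqxx prednK //; congr (_ * _).
by apply: eq_bigr => k /negPf ki; rewrite /lower ki.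
Qed.

(** Coefficientwise this is (j+1) C(e, j+1) = e C(e-1, j). *)
Lemma mderiv_coef_master (R : comNzRingType) (n : nat) (e : 'I_n -> nat) t i :
  ((master R n e)`_t)^`M(i) = - ((master R n (lower n e i))`_t *+ e i).
Proof.
apply/mpolyP => m; rewrite mcoeffN mcoeffMn mcoeff_deriv !mcoeff_master.
rewrite mdegD mdeg1.
have [ei|] := posnP (e i).
  rewrite ei mulr0n oppr0; case: ifP => _; last by rewrite mul0rn.
  rewrite (bigD1 i) //= ei mnmDE mnm1E eqxx addn1 bin0n mulr0n mul0r mul0rn //.
move=> ei; rewrite -(sum_lower n e i ei) addn1 addSn eqSS.
case: ifP => _; last by rewrite !mul0rn oppr0.
rewrite (bigD1 i) //= [in RHS](bigD1 i) //= -!mulrnAl -!mulNr.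
congr (_ * _); last first.
  apply: eq_bigr => k /negPf ki.
  by rewrite /lower ki mnmDE mnm1E eq_sym ki addn0.
rewrite mnmDE mnm1E eqxx addn1 /lower eqxx -!mulrnA exprS mulN1r mulNrn.
by rewrite ![('C(_, _) * _)%N]mulnC mul_bin_diag.
Qed.

(** This is the logarithmic derivative in x, read off at x^t. Coefficientwise, e_i C(e_i - 1, m_i) =
    (e_i - m_i) C(e_i, m_i), and the numbers e_i - m_i add up to t + 1. *)
Lemma sum_lower_master (R : comNzRingType) (n : nat) (e : 'I_n -> nat) t :
  (forall i, 0 < e i)%N ->
  \sum_(i < n) (master R n (lower n e i))`_t *+ e i =
  (master R n e)`_t.+1 *+ t.+1.
Proof.
move=> e_gt0; apply/mpolyP => m; rewrite mcoeffMn raddf_sum /= mcoeff_master.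
rewrite (eq_bigr (fun i => (if (mdeg m + t.+1 == \sum_(k < n) e k)%N
  then \prod_(k < n) ((-1) ^+ m k *+ 'C(e k, m k)) else 0) *+ (e i - m i))).
  rewrite sumrMnr; case: ifP => [/eqP degm|_]; last by rewrite !mul0rn.
  case: (boolP [forall k, m k <= e k]%N) => [/forallP le_me|].
    by rewrite sumnB // -degm mdegE addKn.
  rewrite negb_forall => /existsP[k]; rewrite -ltnNge => lt_em.
  by rewrite (bigD1 k) //= bin_small // mulr0n mul0r !mul0rn.
move=> i _; rewrite mcoeffMn mcoeff_master addnS -(sum_lower n e i) // eqSS.
case: ifP => _; last by rewrite !mul0rn.
rewrite (bigD1 i) //= [in RHS](bigD1 i) //= -!mulrnAl.
congr (_ * _); last by apply: eq_bigr => k /negPf ki; rewrite /lower ki.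
by rewrite /lower eqxx -!mulrnA ![('C(_, _) * _)%N]mulnC mul_bin_down.
Qed.

(** * Coefficients of monomial multiples, and the KZ system with denominators cleared *)

Lemma mcoeffXmM (R : comNzRingType) (n : nat) (f : {mpoly R[n]}) k m :
  ('X_[k] * f)@_m = f@_(m - k) *+ (k <= m)%MM.
Proof.
rewrite mulrC; case: (boolP (k <= m)%MM) => [le_km|nle_km].
  by rewrite -{1}(submK le_km) addmC mcoeffMX.
rewrite mulr0n mcoeffM big1 // => -[m1 m2] /= /eqP mE; rewrite mcoeffX.
case: eqP => [km2|]; last by rewrite mulr0.
by case/negP: nle_km; rewrite mE km2 lem_addl.
Qed.

Lemma lem_Um (n : nat) (i : 'I_n) (m : 'X_{1..n}) :
  (U_(i) <= m)%MM = (0 < m i)%N.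
Proof.
apply/mnm_lepP/idP => [/(_ i)|mi j]; first by rewrite mnm1E eqxx.
by rewrite mnm1E; case: eqP => // <-.
Qed.

Lemma mcoeffXM (R : comNzRingType) (n : nat) (f : {mpoly R[n]}) i m :
  ('X_i * f)@_m = f@_(m - U_(i)) *+ (0 < m i)%N.
Proof. by rewrite mcoeffXmM lem_Um. Qed.

(** For r different from i only the summand j = r of the KZ sum is nonzero; multiplying by z_i - z_r
    and writing M_i for -m_i/q gives the first clause. *)
Definition KZ_poly (R : comNzRingType) (n : nat) (M : 'I_n -> nat)
    (I : 'I_n -> {mpoly R[n]}) : Prop :=
  (forall i r : 'I_n, i != r ->
     ('X_i - 'X_r) * (I r)^`M(i) = (I r - I i) *+ M i) /\
  \sum_(i < n) I i *+ M i = 0.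

Lemma KZ_poly_sub (R : comNzRingType) (n : nat) (M : 'I_n -> nat)
    (I J : 'I_n -> {mpoly R[n]}) :
  KZ_poly R n M I -> KZ_poly R n M J -> KZ_poly R n M (fun i => I i - J i).
Proof.
move=> [I1 I2] [J1 J2]; split.
  move=> i r ir; rewrite mderivB mulrBr I1 // J1 // -mulrnBl; congr (_ *+ _).
  ring.
by under eq_bigr do rewrite mulrnBl; rewrite sumrB I2 J2 subr0.
Qed.

Lemma KZ_poly_mul (R : comNzRingType) (n : nat) (M : 'I_n -> nat)
    (c : {mpoly R[n]}) (I : 'I_n -> {mpoly R[n]}) :
  (forall i, c^`M(i) = 0) ->
  KZ_poly R n M I -> KZ_poly R n M (fun i => c * I i).
Proof.
move=> c0 [I1 I2]; split.
  by move=> i r ir; rewrite mderivM c0 mul0r add0r mulrCA I1 // -mulrBr mulrnAr.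
by under eq_bigr do rewrite -mulrnAr; rewrite -mulr_sumr I2 mulr0.
Qed.

(** With Q the product divided by both x - z_i and x - z_r, the differential equation is (x - z_i)Q
    - (x - z_r)Q = (z_r - z_i)Q. The linear relation holds because the x-derivative has coefficient
    lp times something, hence 0, at x^(lp-1). *)
Lemma KZ_poly_master (R : comNzRingType) (p n : nat) (M : 'I_n -> nat) l :
  p \in [pchar R] -> (0 < l)%N -> (forall i, 0 < M i)%N ->
  KZ_poly R n M (fun i => (master R n (lower n M i))`_(l * p - 1)).
Proof.
move=> pR l_gt0 M_gt0; have p_gt0 := prime_gt0 (pcharf_prime pR); split.
  move=> i r ir; have ri : r != i by rewrite eq_sym.
  pose Q := master R n (lower n (lower n M r) i).
  have Mi : lower n M r i = M i by rewrite /lower (negPf ir).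
  have Mr : lower n M i r = M r by rewrite /lower (negPf ri).
  have QE : Q = master R n (lower n (lower n M i) r).
    apply: eq_bigr => k _; congr (_ ^+ _); rewrite /lower.
    by case: (eqVneq k i) => [->|] //; rewrite (negPf ir).
  rewrite mderiv_coef_master Mi (master_lower R n (lower n M r) i) ?Mi //.
  rewrite (master_lower R n (lower n M i) r) ?Mr // -QE -/Q -coefB.
  have -> : ('X - ('X_i : {mpoly R[n]})%:P) * Q -
            ('X - ('X_r : {mpoly R[n]})%:P) * Q
          = (('X_r - 'X_i : {mpoly R[n]})%:P) * Q by rewrite polyCB; ring.
  by rewrite coefCM -mulNrn mulrnAr mulrN -mulNr opprB.
rewrite sum_lower_master // subn1 prednK ?muln_gt0 ?l_gt0 //.
apply/mpolyP => m.
by rewrite mcoeffMn mcoeff0 mulrnA -mulr_natr (pcharf0 pR) mulr0.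
Qed.

(** * Top coefficients in the KZ equations *)

Lemma ltm_U (n : nat) (i r : 'I_n) :
  (i < r)%N -> (U_(r)%MM < U_(i)%MM :> 'X_{1..n})%O.
Proof.
move=> ir; apply/ltmcP; first by rewrite !mdeg1.
exists i; last by rewrite !mnm1E eqxx -val_eqE /= gtn_eqF.
move=> j ji; rewrite !mnm1E -!val_eqE /= !gtn_eqF //; exact: ltn_trans ir.
Qed.

Section LeadingTerm.

Context (R : idomainType) (n : nat) (M : 'I_n -> nat) (I : 'I_n -> {mpoly R[n]}).
Context (KZI : KZ_poly R n M I) (a : 'X_{1..n}).
Context (bound : forall r m, (a < m)%O -> (I r)@_m = 0).

Lemma submU (i : 'I_n) : (0 < a i)%N -> (a - U_(i) + U_(i))%MM = a.
Proof. by move=> ai; rewrite submK // lem_Um. Qed.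

(** Compare coefficients at z^a. The term z_r dI_r/dz_i would involve the exponent of z^a z_i/z_r,
    which lies above a because z_i > z_r. *)
Lemma lead_ltE (i r : 'I_n) : (i < r)%N ->
  (I r)@_a * (a i)%:R = ((I r)@_a - (I i)@_a) * (M i)%:R.
Proof.
rewrite !mulr_natr; move=> ir; have [/(_ i r) KZ1 _] := KZI.
have /KZ1 : i != r by rewrite -val_eqE /= ltn_eqF.
move=> /(congr1 (mcoeff a)); rewrite mulrBl mcoeffMn !mcoeffB => <-.
rewrite !mcoeffXM !mcoeff_deriv [X in _ - X](_ : _ = 0) ?subr0.
  case: posnP => [->|ai]; first by rewrite !mulr0n.
  rewrite mulr1n submU //; congr (_ *+ _).
  by rewrite mnmBE mnm1E eqxx subn1 prednK.
case: posnP => [|ar]; rewrite // bound ?mul0rn // -{1}(submU r ar).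
by rewrite ltmc_add2r ltm_U.
Qed.

(** Compare coefficients at z^a z_r/z_i, which lies above z^a: the right side and the z_i term
    vanish, and z_r dI_r/dz_i contributes a_i v_r. *)
Lemma lead_gtE (i r : 'I_n) : (r < i)%N -> (I r)@_a * (a i)%:R = 0.
Proof.
rewrite mulr_natr; move=> ri; have [/(_ i r) KZ1 _] := KZI.
have /KZ1 eqI : i != r by rewrite -val_eqE /= gtn_eqF.
have [->|ai] := posnP (a i); first by rewrite mulr0n.
have aiE : a i = ((a - U_(i))%MM i).+1.
  by rewrite mnmBE mnm1E eqxx subn1 prednK.
set b := (a - U_(i))%MM in aiE *; have ab : (b + U_(i))%MM = a by exact: submU.
have lt_ab : (a < (b + U_(r))%MM)%O by rewrite -ab ltmc_add2r ltm_U.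
move: eqI => /(congr1 (mcoeff (b + U_(r))%MM)).
rewrite mulrBl mcoeffMn !mcoeffB !mcoeffXM !mcoeff_deriv.
rewrite !(bound _ _ lt_ab) subr0 mul0rn !mnmDE !mnm1E eqxx.
rewrite [r == i](_ : _ = false) ?addn0 -?val_eqE /= ?ltn_eqF //.
rewrite addn1 /= mulr1n addmK ab.
have [bi0|bi] := posnP (b i).
  rewrite mulr0n sub0r bi0 => /eqP; rewrite oppr_eq0 => /eqP.
  by rewrite aiE bi0.
rewrite mulr1n.
have -> : (b + U_(r) - U_(i) + U_(i) = b + U_(r))%MM.
  by rewrite submK // lem_Um mnmDE ltn_addr.
rewrite (bound _ _ lt_ab) mul0rn sub0r => /eqP; rewrite oppr_eq0 => /eqP.
by rewrite aiE.
Qed.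

End LeadingTerm.

(** * Integers and binomial coefficients in characteristic p *)

Lemma eqr_nat_pchar (R : nzRingType) (p a b : nat) :
  p \in [pchar R] -> (a%:R == b%:R :> R) = (a == b %[mod p]).
Proof.
move=> pR; wlog le_ba : a b / (b <= a)%N => [th|].
  by case: (leqP b a) => [|/ltnW] le_ab; [|rewrite eq_sym [RHS]eq_sym]; exact: th.
by rewrite -subr_eq0 -natrB // -(dvdn_pcharf pR) eqn_mod_dvd.
Qed.

(** C(a, b) divides a!, which is prime to p for a < p. *)
Lemma bin_pchar_neq0 (R : nzRingType) (p a b : nat) :
  p \in [pchar R] -> (a < p)%N -> (b <= a)%N -> ('C(a, b)%:R : R) != 0.
Proof.
move=> pR lt_ap le_ba; rewrite -(dvdn_pcharf pR).
have p_pr := pcharf_prime pR; apply/negP => /(dvdn_mulr (b`! * (a - b)`!)).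
rewrite bin_fact //; apply/negP.
elim: a lt_ap {le_ba} => [|a IHa] lt_ap; first by rewrite dvdn1 gtn_eqF ?prime_gt1.
by rewrite factS Euclid_dvdM // negb_or IHa ?(ltnW lt_ap) // gtnNdvd.
Qed.

(* Indices are 0-based: this is the leading exponent of I^[l] with l = n - 1 - s. *)
Definition lead_exp (p n : nat) (M : 'I_n -> nat) (s : 'I_n) : 'X_{1..n} :=
  [multinom (if (k < s)%N then M k
             else if k == s
             then (\sum_(j < n | (s <= j)%N) M j - (n.-1 - s) * p)%N
             else 0%N) | k < n].

(** * Size and degree of the leading exponents under ample reduction *)

Section LeadingExponents.

Context (p n : nat) (M : 'I_n -> nat) (s : 'I_n).
Context (M_lt_p : forall k, (M k < p)%N).
Context (ample : (n.-1 * p <= \sum_(k < n) M k)%N).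

Lemma sum_lt_const : (\sum_(k < n | (k < s)%N) p = s * p)%N.
Proof.
rewrite -(big_ord_widen n (fun=> p)) ?sum_nat_const ?card_ord //.
exact: ltnW.
Qed.

Lemma sum_gt_const : (\sum_(k < n | (s < k)%N) p = (n.-1 - s) * p)%N.
Proof.
have : (\sum_(k < n) p = n * p)%N by rewrite sum_nat_const card_ord.
rewrite (bigID (fun k : 'I_n => (k < s)%N)) /= sum_lt_const (bigD1 s) ?ltnn //=.
rewrite (eq_bigl (fun k : 'I_n => (s < k)%N)) => [|k]; last first.
  by rewrite -leqNgt [RHS]ltn_neqAle andbC -val_eqE eq_sym.
have := ltn_ord s; nia.
Qed.

Lemma sum_ge_split :
  (\sum_(k < n | (s <= k)%N) M k = M s + \sum_(k < n | (s < k)%N) M k)%N.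
Proof.
rewrite (bigD1 s) //=; congr addn; apply: eq_bigl => k.
by rewrite [RHS]ltn_neqAle andbC -val_eqE eq_sym.
Qed.

Lemma sum_split :
  (\sum_(k < n) M k =
   \sum_(k < n | (k < s)%N) M k + \sum_(k < n | (s <= k)%N) M k)%N.
Proof.
rewrite (bigID (fun k : 'I_n => (k < s)%N)) /=; congr addn.
by apply: eq_bigl => k; rewrite -leqNgt.
Qed.

(** The first s exponents add up to at most sp. Consequently the truncated subtraction in [lead_exp]
    is a true one. *)
Lemma ample_tail : ((n.-1 - s) * p <= \sum_(k < n | (s <= k)%N) M k)%N.
Proof.
have lts : (\sum_(k < n | (k < s)%N) M k <= s * p)%N.
  by rewrite -sum_lt_const leq_sum // => k _; exact: ltnW.
by move: ample; rewrite sum_split mulnBl; lia.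
Qed.

Lemma tail_lt : (s.+1 < n)%N ->
  (\sum_(k < n | (s < k)%N) M k < (n.-1 - s) * p)%N.
Proof.
move=> ltsn; pose k1 := Ordinal ltsn.
(* One index k1 after s exists, and it makes the termwise comparison with p strict. *)
rewrite -sum_gt_const (bigD1 k1) //= [ltnRHS](bigD1 k1) //=.
rewrite -addSn leq_add // leq_sum // => k _; exact: ltnW.
Qed.

(** The n-1-s exponents after s add up to less than (n-1-s)p. The strict inequality keeps the
    leading binomial coefficients nonzero and tells different s apart. *)
Lemma lead_exp_at_lt : (s.+1 < n)%N -> (lead_exp p n M s s < M s)%N.
Proof.
move=> ltsn; have := tail_lt ltsn; have := ample_tail.
rewrite mnmE ltnn eqxx sum_ge_split; lia.
Qed.

Lemma lead_exp_lt_p k : (s.+1 < n)%N -> (lead_exp p n M s k < p)%N.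
Proof.
move=> ltsn; have [->|ks] := eqVneq k s.
  exact: ltn_trans (lead_exp_at_lt ltsn) (M_lt_p s).
rewrite mnmE (negPf ks); case: ifP => // _.
exact: leq_ltn_trans (M_lt_p s).
Qed.

Lemma mdeg_lead_exp :
  (mdeg (lead_exp p n M s) + (n.-1 - s) * p = \sum_(k < n) M k)%N.
Proof.
rewrite sum_split mdegE (bigID (fun k : 'I_n => (k < s)%N)) /= -addnA.
congr addn; first by apply: eq_bigr => k ks; rewrite mnmE ks.
rewrite (bigD1 s) ?ltnn //= big1 ?addn0.
  by rewrite mnmE ltnn eqxx subnK ?ample_tail.
by move=> k /andP[/negPf ks /negPf ns]; rewrite mnmE ks ns.
Qed.

End LeadingExponents.

(** * Leading terms of the hypergeometric solutions *)

Section HypergeometricLead.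

Context (R : idomainType) (p n : nat) (M : 'I_n -> nat) (s : 'I_n).
Context (pR : p \in [pchar R]).
Context (M_gt0 : forall k, (0 < M k)%N).
Context (M_lt_p : forall k, (M k < p)%N).
Context (ample : (n.-1 * p <= \sum_(k < n) M k)%N).
Context (ltsn : (s.+1 < n)%N).

Let hyp (r : 'I_n) := (master R n (lower n M r))`_((n.-1 - s) * p - 1).

Lemma hyp_degree (r : 'I_n) (d : nat) :
  (d + ((n.-1 - s) * p - 1) == \sum_(k < n) lower n M r k)%N =
  (d == mdeg (lead_exp p n M s)).
Proof.
have := mdeg_lead_exp p n M s M_lt_p ample; rewrite -(sum_lower n M r) //.
have : (0 < (n.-1 - s) * p)%N.
  by rewrite muln_gt0 (prime_gt0 (pcharf_prime pR)); lia.
lia.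
Qed.

(** By homogeneity m has the degree of [lead_exp]. Let i be the first index where it is larger. If i
    < s, then m_i > M_i and a binomial coefficient vanishes; if i >= s, then [lead_exp] is zero
    after i and the degree of m would be too large. *)
Lemma mcoeff_hyp_gt (r : 'I_n) m : (lead_exp p n M s < m)%O -> (hyp r)@_m = 0.
Proof.
move=> lt_am; rewrite /hyp mcoeff_master hyp_degree.
case: eqP => // degm; move/(ltmcP (esym degm)): lt_am => [i eq_lt lt_i].
suff Mi : (M i < m i)%N.
  rewrite (bigD1 i) //= bin_small ?mulr0n ?mul0r //.
  by apply: leq_ltn_trans Mi; rewrite /lower; case: ifP => _ //; exact: leq_pred.
have [is_|si] := ltnP i s; first by move: lt_i; rewrite mnmE is_.
have : (mdeg (lead_exp p n M s) < mdeg m)%N; last by rewrite degm ltnn.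
rewrite !mdegE (bigD1 i) //= [ltnRHS](bigD1 i) //= -addSn leq_add // leq_sum //.
move=> k ki; have [/eq_lt -> //|ik] := ltnP k i.
rewrite mnmE [(k < s)%N]ltnNge (leq_trans si ik) /=; case: eqP => // ks.
by move: ki; rewrite -val_eqE eqn_leq ik ks si.
Qed.

(** Component s is the right one: its lowered exponent M_s - 1 still dominates the entry of
    [lead_exp] at s, and the other exponents are not lowered. *)
Lemma mcoeff_hyp_lead : (hyp s)@_(lead_exp p n M s) != 0.
Proof.
rewrite /hyp mcoeff_master hyp_degree eqxx; apply/prodf_neq0 => k _.
rewrite -mulr_natr mulf_neq0 ?signr_eq0 // (bin_pchar_neq0 R p) //.
  by rewrite /lower; case: ifP => _ //; apply: leq_ltn_trans (leq_pred _) _.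
have := lead_exp_at_lt p n M s M_lt_p ample ltsn.
rewrite /lower; case: eqP => [->|/eqP ks]; first by have := M_gt0 s; lia.
by move=> _; rewrite mnmE (negPf ks); case: ifP.
Qed.

End HypergeometricLead.

(** * Leading exponents of arbitrary solutions modulo p *)

Section LeadingClass.

Context (R : idomainType) (p n : nat) (M : 'I_n -> nat) (I : 'I_n -> {mpoly R[n]}).
Context (pR : p \in [pchar R]).
Context (M_gt0 : forall k, (0 < M k)%N).
Context (M_lt_p : forall k, (M k < p)%N).
Context (ample : (n.-1 * p <= \sum_(k < n) M k)%N).
Context (KZI : KZ_poly R n M I).
Context (a : 'X_{1..n}).
Context (bound : forall r m, (a < m)%O -> (I r)@_m = 0).

Let M_neq0 k : (M k)%:R != 0 :> R.
Proof. by rewrite -(dvdn_pcharf pR) gtnNdvd. Qed.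

(** Here s is the first index with v_s nonzero. The relations between v_s and v_k give a_k for k < s
    and for k > s; a_s comes from the linear relation. *)
Lemma lead_exp_class : (exists r, (I r)@_a != 0) ->
  exists s : 'I_n, [/\ (s.+1 < n)%N, (I s)@_a != 0 &
    forall k, (a k %% p)%N = lead_exp p n M s k].
Proof.
case=> r0 v0; pose s := [arg min_(r < r0 | (I r)@_a != 0) r].
have [vs s_min] : (I s)@_a != 0 /\ forall r, (I r)@_a != 0 -> (s <= r)%N.
  by rewrite /s; case: arg_minnP.
have v_lt (r : 'I_n) : (r < s)%N -> (I r)@_a = 0.
  by move=> rs; apply: contraTeq rs => /s_min; rewrite -leqNgt.
have [_ /(congr1 (mcoeff a))] := KZI; rewrite raddf_sum mcoeff0 /=.
under eq_bigr do rewrite mcoeffMn -mulr_natr.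
rewrite (bigID (fun k : 'I_n => (k < s)%N)) /= big1 ?add0r; last first.
  by move=> k ks; rewrite v_lt // mul0r.
rewrite (eq_bigl (fun k : 'I_n => (s <= k)%N)) => [|k]; last by rewrite -leqNgt.
rewrite (bigD1 s) //= => sumI.
(* If s were the last index, the linear relation would read v_s M_s = 0. *)
have ltsn : (s.+1 < n)%N.
  rewrite ltnNge; apply/negP => le_ns; move: sumI; rewrite big1 ?addr0.
    by apply/eqP; rewrite mulf_neq0.
  move=> k /andP[sk]; rewrite -val_eqE eqn_leq sk andbT => /negP[].
  by rewrite -ltnS; apply: leq_trans (ltn_ord k) le_ns.
exists s; split=> // k; apply/eqP.
rewrite -(modn_small (lead_exp_lt_p p n M s M_lt_p ample k ltsn)).
rewrite -(eqr_nat_pchar R) //; have [->|ks] := eqVneq k s.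
  (* Adding (n-1-s)p, which is zero in R, undoes the subtraction in [lead_exp]; both sides are then
     multiplied by v_s M_s. *)
  rewrite mnmE ltnn eqxx -[eqbRHS]addr0 -[0](mulr0 (n.-1 - s)%:R) -(pcharf0 pR).
  rewrite -natrM -natrD subnK ?ample_tail //.
  rewrite -(inj_eq (mulfI (mulf_neq0 vs (M_neq0 s)))) eq_sym -subr_eq0.
  rewrite (bigD1 s) //= natrD natr_sum mulrDr mulr_sumr.
  (* For k0 > s, v_s M_s = v_k0 (M_s - a_s). Weighted by M_k0 and summed, this meets the linear
     relation. *)
  have prodE (k0 : 'I_n) : (s <= k0)%N && (k0 != s) ->
      (I s)@_a * (M s)%:R * (M k0)%:R =
      (I k0)@_a * (M k0)%:R * ((M s)%:R - (a s)%:R).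
    move=> /andP[sk ks]; have lt_sk : (s < k0)%N by rewrite ltn_neqAle eq_sym ks.
    have := lead_ltE R n M I KZI a bound s k0 lt_sk.
    rewrite mulrBl => /eqP; rewrite eq_sym subr_eq => /eqP vk.
    have -> : (I s)@_a * (M s)%:R * (M k0)%:R =
       ((I k0)@_a * (M s)%:R - (I k0)@_a * (a s)%:R) * (M k0)%:R.
      by rewrite vk; ring.
    ring.
  rewrite (eq_bigr _ prodE) -mulr_suml.
  rewrite -(addr0_eq sumI).
  by apply/eqP; ring.
have [lt_ks|le_sk] := ltnP k s.
  have := lead_ltE R n M I KZI a bound k s lt_ks.
  rewrite (v_lt k lt_ks) subr0 => /(mulfI vs) ->.
  by rewrite mnmE lt_ks.
have lt_sk : (s < k)%N by rewrite ltn_neqAle eq_sym ks.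
have /eqP := lead_gtE R n M I KZI a bound k s lt_sk.
rewrite mulf_eq0 (negPf vs) /= => /eqP ->.
by rewrite mnmE ltnNge le_sk (negPf ks).
Qed.

(** Otherwise the residues of a also come from some s' with v_s' nonzero. If s' differs from s, then
    at the smaller index one description gives M and the other a number below M. *)
Lemma lead_vector_eq0 (s : 'I_n) : (s.+1 < n)%N ->
  (forall k, (a k %% p)%N = lead_exp p n M s k) ->
  (I s)@_a = 0 -> forall r, (I r)@_a = 0.
Proof.
move=> ltsn aE vs0 r; apply/eqP/negPn/negP => vr.
have [s' [ltsn' vs' aE']] := lead_exp_class (ex_intro _ r vr).
have [lt_ss|lt_ss|eq_ss] := ltngtP s s'.
- have := lead_exp_at_lt p n M s M_lt_p ample ltsn.
  by rewrite -aE aE' mnmE lt_ss ltnn.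
- have := lead_exp_at_lt p n M s' M_lt_p ample ltsn'.
  by rewrite -aE' aE mnmE lt_ss ltnn.
- by move: vs'; rewrite -(val_inj eq_ss) vs0 eqxx.
Qed.

End LeadingClass.

(** * Generation of all solutions by lowering the leading exponent *)

Lemma max_lead (R : nzRingType) (n : nat) (I : 'I_n -> {mpoly R[n]}) r0 :
  I r0 != 0 ->
  exists2 a : 'X_{1..n}, exists r, (I r)@_a != 0 &
    forall r m, (a < m)%O -> (I r)@_m = 0.
Proof.
move=> I0; pose r1 := [arg max_(r > r0 | I r != 0) mlead (I r)]%O.
have [I1 r1_max] : I r1 != 0 /\
    forall r, I r != 0 -> (mlead (I r) <= mlead (I r1))%O.
  by rewrite /r1; case: Order.TotalTheory.arg_maxP.
exists (mlead (I r1)); first by exists r1; rewrite mleadc_eq0.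
move=> r m lt_m; have [->|/r1_max le_r] := eqVneq (I r) 0; first exact: mcoeff0.
exact/mcoeff_gt_mlead/(le_lt_trans le_r).
Qed.

Definition frob_comp (R : comNzRingType) (n p : nat) (d : {mpoly R[n]}) :
  {mpoly R[n]} := d \mPo [tuple ('X_k : {mpoly R[n]}) ^+ p | k < n].

Lemma frob_compX (R : comNzRingType) (n p : nat) (c : R) (b : 'X_{1..n}) :
  frob_comp R n p (c *: 'X_[b]) = c *: 'X_[(b *+ p)].
Proof.
rewrite /frob_comp comp_mpolyZ comp_mpolyX mpolyXE_id; congr (_ *: _).
by apply: eq_bigr => k _; rewrite tnth_mktuple mulmnE -exprM mulnC.
Qed.

Lemma KZ_poly_generated (R : fieldType) (p n : nat) (M : 'I_n -> nat)
    (pR : p \in [pchar R]) (M_gt0 : forall k, (0 < M k)%N)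
    (M_lt_p : forall k, (M k < p)%N)
    (ample : (n.-1 * p <= \sum_(k < n) M k)%N) (I : 'I_n -> {mpoly R[n]}) :
  KZ_poly R n M I ->
  exists d : nat -> {mpoly R[n]}, forall i, I i =
    \sum_(1 <= l < n) frob_comp R n p (d l) *
      (master R n (lower n M i))`_(l * p - 1).
Proof.
pose gen (J : 'I_n -> {mpoly R[n]}) := exists d : nat -> {mpoly R[n]},
  forall i, J i = \sum_(1 <= l < n) frob_comp R n p (d l) *
      (master R n (lower n M i))`_(l * p - 1).
have gen0 J : (forall r, J r = 0) -> gen J.
  move=> J0; exists (fun=> 0) => i; rewrite J0 big1 // => l _.
  by rewrite /frob_comp comp_mpoly0 mul0r.
suff genI a J : KZ_poly R n M J -> (exists r, (J r)@_a != 0) ->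
    (forall r m, (a < m)%O -> (J r)@_m = 0) -> gen J.
  move=> KZI; case: (pickP (fun r => I r != 0)) => [r /max_lead[a]|I0].
    exact: genI.
  by apply: gen0 => r; apply/eqP; rewrite -[_ == _]negbK I0.
(* The induction on a runs over all solutions J at once, since the subtraction replaces J. *)
move: J; elim/(well_founded_ind (@ltom_wf n)): a => a IH J KZJ nz_a bound.
have [s [ltsn _ aE]] :=
  lead_exp_class R p n M J pR M_gt0 M_lt_p ample KZJ a bound nz_a.
pose l := (n.-1 - s)%N; have l_gt0 : (0 < l)%N by rewrite /l; lia.
have lt_ln : (l < n)%N by rewrite /l; lia.
pose hyp r := (master R n (lower n M r))`_(l * p - 1).
pose e := lead_exp p n M s.
pose b : 'X_{1..n} := [multinom (a k %/ p)%N | k < n].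
have abE : a = (e + b *+ p)%MM.
  by apply/mnmP => k; rewrite mnmDE mulmnE -aE mnmE addnC -divn_eq.
have hyp_s : (hyp s)@_e != 0.
  exact: (mcoeff_hyp_lead R p n M s pR M_gt0 M_lt_p ample ltsn).
(* This scalar cancels component s of the coefficient vector at z^a. *)
pose c := (J s)@_a / (hyp s)@_e.
pose J' r := J r - (c *: 'X_[(b *+ p)]) * hyp r.
have J'E r m : (J' r)@_m =
    (J r)@_m - c * (hyp r)@_(m - b *+ p) *+ (b *+ p <= m)%MM.
  by rewrite mcoeffB -scalerAl mcoeffZ mcoeffXmM mulrnAr.
have KZJ' : KZ_poly R n M J'.
  apply: KZ_poly_sub KZJ _; apply: KZ_poly_mul; last exact: KZ_poly_master pR _ _.
  (* All partial derivatives of z^(pb) vanish in characteristic p. *)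
  move=> i; rewrite mderivZ mderivX mulmnE natrM (pcharf0 pR) mulr0.
  by rewrite !scale0r scaler0.
have bound' r m : (a < m)%O -> (J' r)@_m = 0.
  move=> lt_am; rewrite J'E bound // sub0r.
  case: (boolP (b *+ p <= m)%MM) => [le_m|_]; last by rewrite mulr0n oppr0.
  rewrite (mcoeff_hyp_gt R p n M s pR M_gt0 M_lt_p ample ltsn) ?mulr0 ?oppr0 //.
  by rewrite -(ltmc_add2l _ _ (b *+ p)%MM) submK // -abE.
have J's0 : (J' s)@_a = 0.
  by rewrite J'E abE lem_addl addmK mulr1n -abE /c divfK ?subrr.
(* Cancelling the single component s kills the whole vector at z^a. *)
have J'a0 := lead_vector_eq0 R p n M J' pR M_gt0 M_lt_p ample KZJ' a bound'
  s ltsn aE J's0.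
have [d' d'E] : gen J'.
  case: (pickP (fun r => J' r != 0)) => [r /max_lead[a' nz_a' bound_a']|J'0].
    apply: IH (nz_a') (bound_a') => //.
    case: nz_a' => r1 nz; rewrite ltNge; apply: contra nz.
    by rewrite le_eqVlt => /orP[/eqP<-|/bound'->]; rewrite ?J'a0 eqxx.
  by apply: gen0 => r; apply/eqP; rewrite -[_ == _]negbK J'0.
(* The substitution z_k -> z_k^p turns z^b into z^(pb) and fixes the scalar c. *)
exists (fun k => d' k + (c *: 'X_[b]) *+ (k == l)) => i.
have -> : J i = J' i + c *: 'X_[(b *+ p)] * hyp i by rewrite /J' subrK.
rewrite d'E [RHS](eq_bigr (fun k => frob_comp R n p (d' k) *
      (master R n (lower n M i))`_(k * p - 1) +
      (c *: 'X_[(b *+ p)] * hyp i) *+ (k == l))); last first.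
  move=> k _; rewrite /frob_comp comp_mpolyD mulrDl comp_mpolyMn.
  rewrite -!/(frob_comp R n p _) frob_compX.
  by case: eqP => [->|]; rewrite ?mulr1n ?mulr0n ?mul0r.
rewrite big_split /=; congr (_ + _).
rewrite -ssrcomplements.big_cond_mulrn big_nat1_eq l_gt0 lt_ln //.
Qed.

(** * Passage from the KZ system over F_p to its polynomial form *)

(** From 0 < m_i < q < p both m_i and q are units mod p, so -m_i/q has a nonzero residue and [Mexp]
    is that residue. *)
Lemma Mexp_spec (p q n : nat) (m : 'I_n -> nat) (i : 'I_n) :
  prime p -> (q < p)%N -> (0 < m i < q)%N ->
  [/\ (0 < Mexp p q n m i)%N, (Mexp p q n m i < p)%N &
      (Mexp p q n m i)%:R = - (m i)%:R / q%:R :> 'F_p].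
Proof.
move=> pP qp /andP[mi mq]; rewrite /Mexp; set r := - _ / _ : 'F_p.
have r0 : r != 0.
  rewrite mulf_neq0 ?oppr_eq0 ?invr_eq0 // -(dvdn_pcharf (pchar_Fp pP)).
    by rewrite gtnNdvd // (ltn_trans mq).
  by rewrite gtnNdvd // (ltn_trans mi).
have r_neq0 : (nat_of_ord r == 0%N) = false by apply: negPf; exact: r0.
rewrite r_neq0 natr_Zp; split=> //; first by rewrite lt0n r_neq0.
by rewrite -[ltnRHS](Fp_cast pP) ltn_ord.
Qed.

(** Row r of Omega_ij is zero unless r is i or j. *)
Lemma sum_Omega (p n : nat) (m : 'I_n -> nat) (I : 'I_n -> {mpoly 'F_p[n]})
    (i j r : 'I_n) : i != r -> j != i ->
  \sum_(s < n) (Omega p n m i j r s)%:MP * I s =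
  if j == r then (m i)%:R *: (I i - I r) else 0.
Proof.
move=> ir ji; have ri : (r == i) = false by rewrite eq_sym; exact: negPf.
under eq_bigr do rewrite mxE ri /=.
have [->|jr] := eqVneq j r; last first.
  by rewrite big1 // => s _; rewrite mpolyC0 mul0r.
rewrite (bigD1 i) //= eqxx (bigD1 r) /=; last by rewrite ri.
rewrite eqxx ri big1 ?addr0.
  by rewrite mpolyCN mulNr !mul_mpolyC -scalerBr.
by move=> s /andP[/negPf -> /negPf ->]; rewrite mpolyC0 mul0r.
Qed.

Lemma KZ_solution_poly (p q n : nat) (m : 'I_n -> nat)
    (I : 'I_n -> {mpoly 'F_p[n]}) :
  prime p -> (q < p)%N -> (forall i, 0 < m i < q)%N ->
  KZ_solution p q n m I -> KZ_poly 'F_p n (Mexp p q n m) I.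
Proof.
move=> pP qp mq [KZ1 KZ2].
have natM i (f : {mpoly 'F_p[n]}) :
    f *+ Mexp p q n m i = - (q%:R^-1 *: ((m i)%:R *: f)).
  have [_ _ ME] := Mexp_spec p q n m i pP qp (mq i).
  by rewrite -scaler_nat ME scalerA -scaleNr mulrC mulrN.
split=> [i r ir|]; last first.
  under eq_bigr do rewrite natM.
  rewrite sumrN -scaler_sumr.
  under eq_bigr do rewrite scaler_nat -mulr_natl.
  by rewrite KZ2 scaler0 oppr0.
have ri : r != i by rewrite eq_sym.
have Xir : ('X_i - 'X_r : {mpoly 'F_p[n]}) != 0.
  rewrite subr_eq0; apply: contraNneq ir => /(congr1 (mcoeff U_(i)%MM)).
  by rewrite !mcoeffXU eqxx; case: eqP => // ->; rewrite eqxx.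
(* The identity is checked in the fraction field, where z_i - z_r cancels against the only surviving
   summand j = r. *)
apply/eqP; rewrite -tofrac_eq tofracM KZ1 (bigD1 r) //=.
rewrite [X in _ * (_ + X)]big1 => [|j /andP[ji jr]].
  rewrite sum_Omega // eqxx addr0 mulrCA [X in _ * X]mulrCA.
  rewrite mulfV ?tofrac_eq0 // mulr1 -tofracM mul_mpolyC natM.
  by rewrite tofrac_eq -!scalerN opprB.
by rewrite sum_Omega // (negPf jr) tofrac0 mul0r.
Qed.

Theorem theorem8p3 (p q n : nat) (m : 'I_n -> nat)
    (pP : prime p) (qP : prime q) (n_ge2 : (2 <= n)%N) (n_lt_p : (n < p)%N)
    (q_lt_p : (q < p)%N)
    (m_pos : forall i, (0 < m i)%N) (m_lt_q : forall i, (m i < q)%N)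
    (ample : ((\sum_(i < n) Mexp p q n m i) %/ p)%N = n.-1)
    (I : 'I_n -> {mpoly 'F_p[n]}) :
  KZ_solution p q n m I ->
  exists c : nat -> {mpoly 'F_p[n]},
    (forall l, in_Frob_subring p n (c l)) /\
    forall i : 'I_n, I i = \sum_(1 <= l < n) c l * Ihyp p q n m l i.
Proof.
have mq i : (0 < m i < q)%N by rewrite m_pos m_lt_q.
move=> /(KZ_solution_poly p q n m I pP q_lt_p mq) KZI.
have M_gt0 i : (0 < Mexp p q n m i)%N.
  by have [] := Mexp_spec p q n m i pP q_lt_p (mq i).
have M_lt_p i : (Mexp p q n m i < p)%N.
  by have [] := Mexp_spec p q n m i pP q_lt_p (mq i).
have le_ample : (n.-1 * p <= \sum_(i < n) Mexp p q n m i)%N.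
  by rewrite -ample leq_trunc_div.
have [d dE] := KZ_poly_generated 'F_p p n (Mexp p q n m) (pchar_Fp pP)
  M_gt0 M_lt_p le_ample I KZI.
(* [Ihyp] unfolds to the coefficient of [master] at the lowered exponents, so [dE] is the required
   expansion. *)
by exists (fun l => frob_comp 'F_p n p (d l)); split=> [l|//]; exists (d l).
Qed.
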